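(* Let $GML^n_p$ be a generalized metrical multi-time Lagrange space endowed with the canonical temporal nonlinear connection $M^{(i)}_{(\alpha)\beta}=-H^\mu_{\alpha\beta}x^i_\mu$ and a spatial nonlinear connection $N^{(i)}_{(\alpha)j}$, with Cartan canonical connection $C\Gamma$. Suppose the Einstein equations of $GML^n_p$ hold with a stress-energy d-tensor ${\cal T}$ satisfying the local conservation laws ${\cal T}^B_{A|B}=0$ for all adapted indices $A$. Then the following conservation laws of the Einstein equations hold: $$\left\{\begin{array}{l}\left[H^\mu_\beta-\dfrac{H+R+S}{2}\delta^\mu_\beta\right]_{/\mu}=-R^m_{\beta|m}-P^{(m)}_{(\mu)\beta}|^{(\mu)}_{(m)}\\[3mm] \left[R^m_j-\dfrac{H+R+S}{2}\delta^m_j\right]_{|m}=-P^{(m)}_{(\mu)j}|^{(\mu)}_{(m)}\\[3mm] \left[S^{(m)(\beta)}_{(\mu)(j)}-\dfrac{H+R+S}{2}\delta^m_j\delta^\beta_\mu\right]|^{(\mu)}_{(m)}=-P^{m(\beta)}_{\;\;(j)|m},\end{array}\right.$$ where $$H^\alpha_\beta=h^{\alpha\mu}H_{\mu\beta},\quad R^i_\beta=g^{im}R_{m\beta},\quad R^i_j=g^{im}R_{mj},\quad P^{(i)}_{(\alpha)\beta}=g^{im}h_{\alpha\mu}P^{(\mu)}_{(m)\beta},$$ $$P^{i(\beta)}_{\;\;(j)}=g^{im}P^{\;\;(\beta)}_{m(j)},\quad P^{(i)}_{(\alpha)j}=g^{im}h_{\alpha\mu}P^{(\mu)}_{(m)j},\quad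 S^{(i)(\beta)}_{(\alpha)(j)}=g^{im}h_{\alpha\mu}S^{(\mu)(\beta)}_{(m)(j)}.$$
   Context: Setting. $T$ and $M$ are smooth real manifolds of dimensions $p$ and $n$, with local coordinates $(t^\alpha)$ and $(x^i)$; Greek indices run over $1,\dots,p$, Latin indices over $1,\dots,n$, and the summation convention is used. $E=J^1(T,M)\to T\times M$ is the first order jet bundle, with coordinates $(t^\alpha,x^i,x^i_\alpha)$ which change by $\tilde t^\alpha=\tilde t^\alpha(t^\beta)$, $\tilde x^i=\tilde x^i(x^j)$, $\tilde x^i_\alpha=\frac{\partial\tilde x^i}{\partial x^j}\frac{\partial t^\beta}{\partial\tilde t^\alpha}x^j_\beta$. A d-tensor on $E$ is a family of local functions on $E$ transforming tensorially: Greek indices with the Jacobian of $t\mapsto\tilde t$, Latin indices with that of $x\mapsto\tilde x$; indices in parentheses refer to vertical directions. $h=(h_{\alpha\beta}(t))$ is a fixed semi-Riemannian metric on $T$ with inverse $h^{\alpha\beta}$ and Christoffel symbols $H^\gamma_{\alpha\beta}$. $g_{ij}(t^\gamma,x^k,x^k_\gamma)$ is a d-tensor on $E$, symmetric, of rank $n$, of constant signature, with inverse $g^{ij}$. The pair $GML^n_p=(E,\,G^{(\alpha)(\beta)}_{(i)(j)}=h^{\alpha\beta}g_{ij})$ is called a generalized metrical multi-time Lagrange space. Nonlinear connection. $\Gamma=(M^{(i)}_{(\alpha)\beta},N^{(i)}_{(\alpha)j})$ is a family of local functions on $E$ such that $\frac{\delta}{\delta t^\alpha}=\frac{\partial}{\partial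 t^\alpha}-M^{(j)}_{(\beta)\alpha}\frac{\partial}{\partial x^j_\beta}$ and $\frac{\delta}{\delta x^i}=\frac{\partial}{\partial x^i}-N^{(j)}_{(\beta)i}\frac{\partial}{\partial x^j_\beta}$ transform tensorially. The adapted basis is $(X_A)=\left(\frac{\delta}{\delta t^\alpha},\frac{\delta}{\delta x^i},\frac{\partial}{\partial x^i_\alpha}\right)$. Cartan canonical connection. $C\Gamma=(H^\gamma_{\alpha\beta},G^k_{j\gamma},L^i_{jk},C^{i(\gamma)}_{j(k)})$, where $G^k_{j\gamma}=\frac{g^{ki}}{2}\frac{\delta g_{ij}}{\delta t^\gamma}$, $L^i_{jk}=\frac{g^{im}}{2}\left(\frac{\delta g_{mj}}{\delta x^k}+\frac{\delta g_{mk}}{\delta x^j}-\frac{\delta g_{jk}}{\delta x^m}\right)$, $C^{i(\gamma)}_{j(k)}=\frac{g^{im}}{2}\left(\frac{\partial g_{mj}}{\partial x^k_\gamma}+\frac{\partial g_{mk}}{\partial x^j_\gamma}-\frac{\partial g_{jk}}{\partial x^m_\gamma}\right)$, is the linear connection $\nabla$ on $E$ given by $\nabla_{\delta/\delta t^\gamma}\frac{\delta}{\delta t^\alpha}=H^\beta_{\alpha\gamma}\frac{\delta}{\delta t^\beta}$, $\nabla_{\delta/\delta x^k}\frac{\delta}{\delta t^\alpha}=0$, $\nabla_{\partial/\partial x^k_\gamma}\frac{\delta}{\delta t^\alpha}=0$; $\nabla_{\delta/\delta t^\gamma}\frac{\delta}{\delta x^j}=G^k_{j\gamma}\frac{\delta}{\delta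 x^k}$, $\nabla_{\delta/\delta x^k}\frac{\delta}{\delta x^j}=L^i_{jk}\frac{\delta}{\delta x^i}$, $\nabla_{\partial/\partial x^k_\gamma}\frac{\delta}{\delta x^j}=C^{i(\gamma)}_{j(k)}\frac{\delta}{\delta x^i}$; $\nabla_{\delta/\delta t^\gamma}\frac{\partial}{\partial x^i_\alpha}=G^k_{i\gamma}\frac{\partial}{\partial x^k_\alpha}-H^\alpha_{\eta\gamma}\frac{\partial}{\partial x^i_\eta}$, $\nabla_{\delta/\delta x^k}\frac{\partial}{\partial x^i_\alpha}=L^l_{ik}\frac{\partial}{\partial x^l_\alpha}$, $\nabla_{\partial/\partial x^k_\gamma}\frac{\partial}{\partial x^i_\alpha}=C^{l(\gamma)}_{i(k)}\frac{\partial}{\partial x^l_\alpha}$. Local covariant derivatives of a d-tensor $D$ (indices in parentheses treated like ordinary ones according to position and type): $D_{/\varepsilon}$ is $\frac{\delta D}{\delta t^\varepsilon}$ plus, for each upper Latin index $i$, a term with $G^i_{m\varepsilon}$ ($i$ replaced by $m$), minus, for each lower Latin index $k$, a term with $G^m_{k\varepsilon}$, plus, for each upper Greek index $\alpha$, a term with $H^\alpha_{\mu\varepsilon}$, minus, for each lower Greek index $\gamma$, a term with $H^\mu_{\gamma\varepsilon}$. $D_{|k}$ is $\frac{\delta D}{\delta x^k}$ plus a term with $L^i_{mk}$ for each upper Latin index $i$, minus a term with $L^m_{jk}$ for each lower Latin index $j$. $D|^{(\gamma)}_{(k)}$ is $\frac{\partial D}{\partial x^k_\gamma}$ plus a term with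 $C^{i(\gamma)}_{m(k)}$ for each upper Latin index $i$, minus a term with $C^{m(\gamma)}_{j(k)}$ for each lower Latin index $j$. (No terms for Greek indices in the last two.) Curvature: $\mathbf R(X,Y)Z=\nabla_X\nabla_YZ-\nabla_Y\nabla_XZ-\nabla_{[X,Y]}Z$; the named curvature d-tensors are given by $\mathbf R(\frac{\delta}{\delta t^\gamma},\frac{\delta}{\delta t^\beta})\frac{\delta}{\delta t^\eta}=H^\alpha_{\eta\beta\gamma}\frac{\delta}{\delta t^\alpha}$; $\mathbf R(\frac{\delta}{\delta x^k},\frac{\delta}{\delta t^\beta})\frac{\delta}{\delta x^i}=R^l_{i\beta k}\frac{\delta}{\delta x^l}$; $\mathbf R(\frac{\delta}{\delta x^k},\frac{\delta}{\delta x^j})\frac{\delta}{\delta x^i}=R^l_{ijk}\frac{\delta}{\delta x^l}$; $\mathbf R(\frac{\partial}{\partial x^k_\gamma},\frac{\delta}{\delta t^\beta})\frac{\delta}{\delta x^i}=P^{l\;(\gamma)}_{i\beta(k)}\frac{\delta}{\delta x^l}$; $\mathbf R(\frac{\partial}{\partial x^k_\gamma},\frac{\delta}{\delta x^j})\frac{\delta}{\delta x^i}=P^{l\;(\gamma)}_{ij(k)}\frac{\delta}{\delta x^l}$; $\mathbf R(\frac{\partial}{\partial x^k_\gamma},\frac{\partial}{\partial x^j_\beta})\frac{\delta}{\delta x^i}=S^{l(\beta)(\gamma)}_{i(j)(k)}\frac{\delta}{\delta x^l}$. Ricci components: $H_{\alpha\beta}=H^\mu_{\alpha\beta\mu}$,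 $R_{i\alpha}=R^m_{i\alpha m}$, $R_{ij}=R^m_{ijm}$, $P^{\;(\alpha)}_{i(j)}=-P^{m\;(\alpha)}_{im(j)}$, $P^{(\alpha)}_{(i)j}=P^{m\;(\alpha)}_{ij(m)}$, $P^{(\alpha)}_{(i)\beta}=P^{m\;(\alpha)}_{i\beta(m)}$, $S^{(\alpha)(\beta)}_{(i)(j)}=S^{m(\beta)(\alpha)}_{i(j)(m)}$; $H=h^{\alpha\beta}H_{\alpha\beta}$, $R=g^{ij}R_{ij}$, $S=h_{\alpha\beta}g^{ij}S^{(\alpha)(\beta)}_{(i)(j)}$. Einstein equations (${\cal K}$ the Einstein constant, ${\cal T}$ the stress-energy d-tensor with adapted components ${\cal T}_{AB}$): $H_{\alpha\beta}-\frac{H+R+S}{2}h_{\alpha\beta}={\cal K}{\cal T}_{\alpha\beta}$, $R_{ij}-\frac{H+R+S}{2}g_{ij}={\cal K}{\cal T}_{ij}$, $S^{(\alpha)(\beta)}_{(i)(j)}-\frac{H+R+S}{2}h^{\alpha\beta}g_{ij}={\cal K}{\cal T}^{(\alpha)(\beta)}_{(i)(j)}$, ${\cal T}_{\alpha i}=0$, ${\cal T}^{\;(\beta)}_{\alpha(i)}=0$, $R_{i\alpha}={\cal K}{\cal T}_{i\alpha}$, $P^{(\alpha)}_{(i)\beta}={\cal K}{\cal T}^{(\alpha)}_{(i)\beta}$, $P^{\;(\alpha)}_{i(j)}={\cal K}{\cal T}^{\;(\alpha)}_{i(j)}$, $P^{(\alpha)}_{(i)j}={\cal K}{\cal T}^{(\alpha)}_{(i)j}$.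 The law ${\cal T}^B_{A|B}=0$, where ${\cal T}^B_A=G^{BD}{\cal T}_{DA}$ and $G^{BD}$ has blocks $h^{\alpha\beta}$, $g^{ij}$, $h_{\alpha\beta}g^{ij}$ (zero elsewhere), means ${\cal T}^\mu_{A/\mu}+{\cal T}^m_{A|m}+{\cal T}^{(m)}_{(\mu)A}|^{(\mu)}_{(m)}=0$ for each index $A$ of type $\alpha$, $i$ or ${(\alpha)\atop(i)}$, with ${\cal T}^\mu_A=h^{\mu\nu}{\cal T}_{\nu A}$, ${\cal T}^m_A=g^{mk}{\cal T}_{kA}$, ${\cal T}^{(m)}_{(\mu)A}=g^{mk}h_{\mu\nu}{\cal T}^{(\nu)}_{(k)A}$. *)

(* Defs.v *)
From HB Require Import structures.
From mathcomp Require Import all_boot all_order all_algebra.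
From mathcomp Require Import all_classical all_reals all_analysis.

Set Implicit Arguments.
Unset Strict Implicit.
Unset Printing Implicit Defensive.

Import Order.TTheory GRing.Theory Num.Theory.
Import numFieldNormedType.Exports.

Local Open Scope classical_set_scope.
Local Open Scope ring_scope.

(** * Smooth maps and smooth manifolds *)

(* [Ck k A f]: [f] is of class C^k on the open set [A] (in finite dimension). *)
Fixpoint Ck (R : realType) (V W : normedModType R) (k : nat) (A : set V)
    (f : V -> W) : Prop :=
  match k with
  | 0 => forall x, A x -> {for x, continuous f}
  | k'.+1 => (forall x, A x -> differentiable f x)
             /\ (forall v, Ck k' A (fun x => 'D_v f x))
  end.

Definition smooth_on (R : realType) (V W : normedModType R) (A : set V)
  (f : V -> W) : Prop := forall k, Ck k A f.

(* [par c] is only meaningful on [crd c @` dom c], where it inverts [crd c]. *)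
Record manifold (R : realType) (d : nat) := Manifold {
  carrier :> topologicalType;
  chart : Type;
  dom : chart -> set carrier;
  crd : chart -> carrier -> 'rV[R]_d;
  par : chart -> 'rV[R]_d -> carrier;
  manifold_hausdorff : hausdorff_space carrier;
  manifold_second_countable : @second_countable carrier;
  dom_open : forall c, open (dom c);
  img_open : forall c, open (crd c @` dom c);
  crdK : forall c x, dom c x -> par c (crd c x) = x;
  crd_continuous : forall c x, dom c x -> {for x, continuous (crd c)};
  par_continuous : forall c t, (crd c @` dom c) t -> {for t, continuous (par c)};
  chart_cover : forall x, exists c, dom c x;
  chart_compatible : forall c c',
    smooth_on (crd c @` (dom c `&` dom c')) (crd c' \o par c)
}.

Arguments chart {R d} m.

Section Charts.
Variables (R : realType) (d : nat) (X : manifold R d).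

Definition img (c : chart X) : set 'rV[R]_d := crd c @` dom c.

Definition overlap (c c' : chart X) : set 'rV[R]_d :=
  crd c @` (dom c `&` dom c').

Definition trans (c c' : chart X) : 'rV[R]_d -> 'rV[R]_d := crd c' \o par c.

(* entry (a, b) : the partial derivative of the a-th new coordinate with
   respect to the b-th old one (the transpose of the library's ['J]) *)
Definition jac (c c' : chart X) (t : 'rV[R]_d) : 'M[R]_d :=
  \matrix_(a, b) ('D_(delta_mx 0 b) (trans c c') t) 0 a.

End Charts.

(* [A] is congruent to diag(1, .., 1, -1, .., -1) with [r] entries equal to 1 *)
Definition has_signature (R : realType) (d : nat) (r : nat) (A : 'M[R]_d) :
    Prop :=
  exists2 P : 'M[R]_d, P \in unitmx &
    P *m A *m P^T = diag_mx (\row_(i < d) (if (i < r)%N then 1 else -1)).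

Definition semi_riemannian (R : realType) (d : nat) (X : manifold R d)
    (h : chart X -> 'rV[R]_d -> 'M[R]_d) : Prop :=
  [/\ forall c a b, smooth_on (img c) (fun t => h c t a b),
      forall c c' t, overlap c c' t -> forall a b,
        h c' (trans c c' t) a b =
        \sum_m \sum_n jac c' c (trans c c' t) m a *
                      jac c' c (trans c c' t) n b * h c t m n,
      forall c t, img c t -> (h c t)^T = h c t,
      forall c t, img c t -> h c t \in unitmx &
      exists r, forall c t, img c t -> has_signature r (h c t)].

(** * Local coordinates and d-tensors on J^1(T, M) *)

(* Local coordinates (t^a, x^i, x^i_a); x^i_a is the entry (i, a) of the
   last component. *)
Notation jco R p n := ('rV[R]_p * 'rV[R]_n * 'M[R]_(n, p))%type.

(* Kinds of tensor indices: upper/lower, Greek (T) / Latin (X).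
   A d-tensor with slots [s] has, in each chart, a component for every element
   of [mix p n s]; a vertical index (a pair of parenthesised indices, one Latin and
   one Greek, in opposite positions) occupies two slots. *)
Inductive slot := UpT | LoT | UpX | LoX.

Definition sidx (p n : nat) (s : slot) : finType :=
  match s with UpT | LoT => 'I_p | UpX | LoX => 'I_n end.

Fixpoint mix (p n : nat) (s : seq slot) : Type :=
  match s with
  | [::] => unit
  | sl :: s' => (sidx p n sl * mix p n s')%type
  end.

Fixpoint curried (p n : nat) (F : Type) (s : seq slot) : Type :=
  match s with
  | [::] => F
  | sl :: s' => sidx p n sl -> curried p n F s'
  end.

Fixpoint tens (p n : nat) (F : Type) (s : seq slot) :
    curried p n F s -> mix p n s -> F :=
  match s with
  | [::] => fun f _ => f
  | sl :: s' => fun f I => tens (f I.1) I.2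
  end.
Arguments tens {p n F} s _ _.

(* The three types of adapted indices, and the slots of a lower adapted index;
   the vertical one, dual to x^i_a, has (i) below and (a) above. *)
Inductive kind := Kt | Kx | Kv.

Definition low (A : kind) : seq slot :=
  match A with Kt => [:: LoT] | Kx => [:: LoX] | Kv => [:: LoX; UpT] end.

(* Components T_{AB} in one chart of a tensor of type (0, 2) on E; e.g. the
   argument of [T Kv Kx] is (i, (a, (j, tt))) for the indices (a)(i), j. *)
Definition blocks (R : realType) (p n : nat) : Type :=
  forall A B : kind, mix p n (low A ++ low B) -> jco R p n -> R.

Section JetCharts.
Variables (R : realType) (p n : nat) (T : manifold R p) (M : manifold R n).
Local Notation J := (jco R p n).

Definition jdom (c : chart T) (d : chart M) : set J :=
  [set u | img c u.1.1 /\ img d u.1.2].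

Definition joverlap (c c' : chart T) (d d' : chart M) : set J :=
  [set u | overlap c c' u.1.1 /\ overlap d d' u.1.2].

Definition jtrans (c c' : chart T) (d d' : chart M) (u : J) : J :=
  (trans c c' u.1.1, trans d d' u.1.2,
   jac d d' u.1.2 *m u.2 *m jac c' c (trans c c' u.1.1)).

(* the factor of the transformation law attached to one index *)
Definition jac_slot (c c' : chart T) (d d' : chart M) (u : J) (sl : slot) :
    sidx p n sl -> sidx p n sl -> R :=
  match sl return sidx p n sl -> sidx p n sl -> R with
  | UpT => fun a b => jac c c' u.1.1 a b
  | LoT => fun a b => jac c' c (trans c c' u.1.1) b a
  | UpX => fun i j => jac d d' u.1.2 i j
  | LoX => fun i j => jac d' d (trans d d' u.1.2) j i
  end.

Fixpoint transform (c c' : chart T) (d d' : chart M) (u : J) (s : seq slot) :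
    (mix p n s -> R) -> mix p n s -> R :=
  match s with
  | [::] => fun D I => D I
  | sl :: s' => fun D I =>
      \sum_m jac_slot c c' d d' u I.1 m *
        transform c c' d d' u (fun K => D (m, K)) I.2
  end.

Definition dtensor (s : seq slot)
    (D : chart T -> chart M -> mix p n s -> J -> R) : Prop :=
  (forall c d I, smooth_on (jdom c d) (D c d I)) /\
  (forall c c' d d' u, joverlap c c' d d' u ->
     forall I, D c' d' I (jtrans c c' d d' u) =
               transform c c' d d' u (fun K => D c d K u) I).

End JetCharts.

Arguments dtensor {R p n T M} s D.

(** * Geometry in one chart of E *)

(* [lM j b a u] is M^{(j)}_{(b)a} and [lN j b i u] is N^{(j)}_{(b)i} at u. *)
Record local_space (R : realType) (p n : nat) := LocalSpace {
  lh : 'rV[R]_p -> 'M[R]_p;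
  lg : jco R p n -> 'M[R]_n;
  lM : 'I_n -> 'I_p -> 'I_p -> jco R p n -> R;
  lN : 'I_n -> 'I_p -> 'I_n -> jco R p n -> R
}.

Definition aidx (p n : nat) : finType := ('I_p + 'I_n + 'I_n * 'I_p)%type.
Notation It a := (inl (inl a)).
Notation Ix i := (inl (inr i)).
Notation Iv i a := (inr (i, a)).

(* [christoffel h c a b t] is H^c_{ab}(t) *)
Definition christoffel (R : realType) (p : nat) (h : 'rV[R]_p -> 'M[R]_p)
    (c a b : 'I_p) (t : 'rV[R]_p) : R :=
  \sum_e invmx (h t) c e / 2 *
    ('D_(delta_mx 0 b) (fun s => h s e a) t
     + 'D_(delta_mx 0 a) (fun s => h s e b) t
     - 'D_(delta_mx 0 e) (fun s => h s a b) t).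

Definition canonical_M (R : realType) (p n : nat) (h : 'rV[R]_p -> 'M[R]_p)
    (i : 'I_n) (a b : 'I_p) (u : jco R p n) : R :=
  - \sum_m christoffel h m a b u.1.1 * u.2 i m.

Section LocalGeometry.
Variables (R : realType) (p n : nat) (Q : local_space R p n).
Local Notation J := (jco R p n).
Local Notation h := (lh Q).
Local Notation g := (lg Q).

Definition hi (u : J) : 'M[R]_p := invmx (h u.1.1).
Definition gi (u : J) : 'M[R]_n := invmx (g u).

(* G^{(a)(b)}_{(i)(j)} *)
Definition vmetric (i : 'I_n) (a : 'I_p) (j : 'I_n) (b : 'I_p) (u : J) : R :=
  hi u a b * g u i j.

Definition ddt (a : 'I_p) : J := (delta_mx 0 a, 0, 0).
Definition ddx (i : 'I_n) : J := (0, delta_mx 0 i, 0).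
Definition ddv (i : 'I_n) (a : 'I_p) : J := (0, 0, delta_mx i a).

Definition frame (A : aidx p n) (u : J) : J :=
  match A with
  | It a => ddt a - \sum_j \sum_b lM Q j b a u *: ddv j b
  | Ix i => ddx i - \sum_j \sum_b lN Q j b i u *: ddv j b
  | Iv i a => ddv i a
  end.

(* the components of a vector field in the adapted basis: its values on the
   dual basis dt^a, dx^i, dx^i_a + M^{(i)}_{(a)b} dt^b + N^{(i)}_{(a)j} dx^j *)
Definition coframe (A : aidx p n) (X : J -> J) (u : J) : R :=
  match A with
  | It a => (X u).1.1 0 a
  | Ix i => (X u).1.2 0 i
  | Iv i a => (X u).2 i a + \sum_b lM Q i a b u * (X u).1.1 0 b
                          + \sum_j lN Q i a j u * (X u).1.2 0 j
  end.

(* the derivative of a function along an element of the adapted basis *)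
Definition delta (A : aidx p n) (f : J -> R) (u : J) : R :=
  'D_(frame A u) f u.

(* [cH c a b], [cG k j c], [cL i j k], [cC i j k c] are H^c_{ab}, G^k_{jc},
   L^i_{jk}, C^{i(c)}_{j(k)} *)
Definition cH (c a b : 'I_p) (u : J) : R := christoffel h c a b u.1.1.

Definition cG (k j : 'I_n) (c : 'I_p) (u : J) : R :=
  \sum_i gi u k i / 2 * delta (It c) (fun v => g v i j) u.

Definition cL (i j k : 'I_n) (u : J) : R :=
  \sum_m gi u i m / 2 * (delta (Ix k) (fun v => g v m j) u
                         + delta (Ix j) (fun v => g v m k) u
                         - delta (Ix m) (fun v => g v j k) u).

Definition cC (i j k : 'I_n) (c : 'I_p) (u : J) : R :=
  \sum_m gi u i m / 2 * (delta (Iv k c) (fun v => g v m j) u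
                         + delta (Iv j c) (fun v => g v m k) u
                         - delta (Iv m c) (fun v => g v j k) u).

(* [nabla_frame A B] is nabla_{X_A} X_B *)
Definition nabla_frame (A B : aidx p n) (u : J) : J :=
  match B, A with
  | It a, It c => \sum_b cH b a c u *: frame (It b) u
  | It a, Ix k => 0
  | It a, Iv k c => 0
  | Ix j, It c => \sum_k cG k j c u *: frame (Ix k) u
  | Ix j, Ix k => \sum_i cL i j k u *: frame (Ix i) u
  | Ix j, Iv k c => \sum_i cC i j k c u *: frame (Ix i) u
  | Iv i a, It c => \sum_k cG k i c u *: frame (Iv k a) u
                    - \sum_e cH a e c u *: frame (Iv i e) u
  | Iv i a, Ix k => \sum_l cL l i k u *: frame (Iv l a) u
  | Iv i a, Iv k c => \sum_l cC l i k c u *: frame (Iv l a) u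
  end.

Definition nabla (X Y : J -> J) (u : J) : J :=
  \sum_A \sum_B coframe A X u *:
    (delta A (coframe B Y) u *: frame B u
     + coframe B Y u *: nabla_frame A B u).

Definition lie (X Y : J -> J) (u : J) : J := 'D_(X u) Y u - 'D_(Y u) X u.

Definition Riem (X Y Z : J -> J) (u : J) : J :=
  nabla X (nabla Y Z) u - nabla Y (nabla X Z) u - nabla (lie X Y) Z u.

(* H^a_{e b c} *)
Definition curvH (a e b c : 'I_p) : J -> R :=
  coframe (It a) (Riem (frame (It c)) (frame (It b)) (frame (It e))).
(* R^l_{i b k} *)
Definition curvRt (l i : 'I_n) (b : 'I_p) (k : 'I_n) : J -> R :=
  coframe (Ix l) (Riem (frame (Ix k)) (frame (It b)) (frame (Ix i))).
(* R^l_{i j k} *)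
Definition curvR (l i j k : 'I_n) : J -> R :=
  coframe (Ix l) (Riem (frame (Ix k)) (frame (Ix j)) (frame (Ix i))).
(* P^{l (c)}_{i b (k)} *)
Definition curvPt (l i : 'I_n) (b : 'I_p) (k : 'I_n) (c : 'I_p) : J -> R :=
  coframe (Ix l) (Riem (frame (Iv k c)) (frame (It b)) (frame (Ix i))).
(* P^{l (c)}_{i j (k)} *)
Definition curvP (l i j k : 'I_n) (c : 'I_p) : J -> R :=
  coframe (Ix l) (Riem (frame (Iv k c)) (frame (Ix j)) (frame (Ix i))).
(* S^{l (b)(c)}_{i (j)(k)} *)
Definition curvS (l i j : 'I_n) (b : 'I_p) (k : 'I_n) (c : 'I_p) : J -> R :=
  coframe (Ix l) (Riem (frame (Iv k c)) (frame (Iv j b)) (frame (Ix i))).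

(* H_{ab}, R_{ia}, R_{ij} *)
Definition ricH (a b : 'I_p) (u : J) : R := \sum_m curvH m a b m u.
Definition ricRt (i : 'I_n) (a : 'I_p) (u : J) : R := \sum_m curvRt m i a m u.
Definition ricR (i j : 'I_n) (u : J) : R := \sum_m curvR m i j m u.
(* P_{i (j)}^{(a)}, P^{(a)}_{(i) j}, P^{(a)}_{(i) b} *)
Definition ricPxv (i j : 'I_n) (a : 'I_p) (u : J) : R :=
  - \sum_m curvP m i m j a u.
Definition ricPvx (i : 'I_n) (a : 'I_p) (j : 'I_n) (u : J) : R :=
  \sum_m curvP m i j m a u.
Definition ricPvt (i : 'I_n) (a b : 'I_p) (u : J) : R :=
  \sum_m curvPt m i b m a u.
(* S^{(a)(b)}_{(i)(j)} *)
Definition ricS (i : 'I_n) (a : 'I_p) (j : 'I_n) (b : 'I_p) (u : J) : R :=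
  \sum_m curvS m i j b m a u.

Definition scalH (u : J) : R := \sum_a \sum_b hi u a b * ricH a b u.
Definition scalR (u : J) : R := \sum_i \sum_j gi u i j * ricR i j u.
Definition scalS (u : J) : R :=
  \sum_a \sum_b \sum_i \sum_j h u.1.1 a b * gi u i j * ricS i a j b u.

Definition half_scal (u : J) : R := (scalH u + scalR u + scalS u) / 2.

(* H^a_b, R^i_b, R^i_j *)
Definition upH (a b : 'I_p) (u : J) : R := \sum_m hi u a m * ricH m b u.
Definition upRt (i : 'I_n) (b : 'I_p) (u : J) : R :=
  \sum_m gi u i m * ricRt m b u.
Definition upR (i j : 'I_n) (u : J) : R := \sum_m gi u i m * ricR m j u.
(* P^{(i)}_{(a) b}, P^{i (b)}_{(j)}, P^{(i)}_{(a) j} *)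
Definition upPvt (i : 'I_n) (a b : 'I_p) (u : J) : R :=
  \sum_m \sum_e gi u i m * h u.1.1 a e * ricPvt m e b u.
Definition upPxv (i j : 'I_n) (b : 'I_p) (u : J) : R :=
  \sum_m gi u i m * ricPxv m j b u.
Definition upPvx (i : 'I_n) (a : 'I_p) (j : 'I_n) (u : J) : R :=
  \sum_m \sum_e gi u i m * h u.1.1 a e * ricPvx m e j u.
(* S^{(i)(b)}_{(a)(j)} *)
Definition upS (i : 'I_n) (a : 'I_p) (j : 'I_n) (b : 'I_p) (u : J) : R :=
  \sum_m \sum_e gi u i m * h u.1.1 a e * ricS m e j b u.

(* Local covariant derivatives: [cov (It e) D], [cov (Ix k) D],
   [cov (Iv k c) D] are D_{/e}, D_{|k}, D|^{(c)}_{(k)}; [cov_coef] is the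
   signed connection coefficient attached to one index of D. *)
Definition cov_coef (A : aidx p n) (sl : slot) (u : J) :
    sidx p n sl -> sidx p n sl -> R :=
  match sl return sidx p n sl -> sidx p n sl -> R with
  | UpT => fun a m => if A is It e then cH a m e u else 0
  | LoT => fun c m => if A is It e then - cH m c e u else 0
  | UpX => fun i m => match A with
                      | It e => cG i m e u
                      | Ix k => cL i m k u
                      | Iv k c => cC i m k c u
                      end
  | LoX => fun j m => match A with
                      | It e => - cG m j e u
                      | Ix k => - cL m j k u
                      | Iv k c => - cC m j k c u
                      end
  end.

Fixpoint cov (A : aidx p n) (s : seq slot) :
    (mix p n s -> J -> R) -> mix p n s -> J -> R :=
  match s with
  | [::] => fun D I u => delta A (D I) u
  | sl :: s' => fun D I u =>
      cov A (fun K => D (I.1, K)) I.2 u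
      + \sum_m cov_coef A u I.1 m * D (m, I.2) u
  end.

Variables (kappa : R) (T : blocks R p n).

Definition einstein_equations (u : J) : Prop :=
  (forall a b, ricH a b u - half_scal u * h u.1.1 a b
                = kappa * T (A := Kt) (B := Kt) (a, (b, tt)) u) /\
  (forall i j, ricR i j u - half_scal u * g u i j
                = kappa * T (A := Kx) (B := Kx) (i, (j, tt)) u) /\
  (forall i a j b, ricS i a j b u - half_scal u * vmetric i a j b u
                = kappa * T (A := Kv) (B := Kv) (i, (a, (j, (b, tt)))) u) /\
  (forall a i, T (A := Kt) (B := Kx) (a, (i, tt)) u = 0) /\
  (forall a i b, T (A := Kt) (B := Kv) (a, (i, (b, tt))) u = 0) /\
  (forall i a, ricRt i a u = kappa * T (A := Kx) (B := Kt) (i, (a, tt)) u) /\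
  (forall i a b, ricPvt i a b u
                = kappa * T (A := Kv) (B := Kt) (i, (a, (b, tt))) u) /\
  (forall i j a, ricPxv i j a u
                = kappa * T (A := Kx) (B := Kv) (i, (j, (a, tt))) u) /\
  (forall i a j, ricPvx i a j u
                = kappa * T (A := Kv) (B := Kx) (i, (a, (j, tt))) u).

(* T^mu_A, T^m_A, T^{(m)}_{(mu) A}: the first index raised with the metric
   whose blocks are h^{ab}, g^{ij}, h_{ab} g^{ij} *)
Definition upTt (A : kind) (I : mix p n (UpT :: low A)) (u : J) : R :=
  \sum_e hi u I.1 e * T (A := Kt) (B := A) (e, I.2) u.
Definition upTx (A : kind) (I : mix p n (UpX :: low A)) (u : J) : R :=
  \sum_k gi u I.1 k * T (A := Kx) (B := A) (k, I.2) u.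
Definition upTv (A : kind) (I : mix p n (UpX :: LoT :: low A)) (u : J) : R :=
  \sum_k \sum_e gi u I.1 k * h u.1.1 I.2.1 e *
    T (A := Kv) (B := A) (k, (e, I.2.2)) u.

Definition conservation_laws (u : J) : Prop :=
  forall (A : kind) (I : mix p n (low A)),
    \sum_m cov (s := UpT :: low A) (It m) (@upTt A) (m, I) u
    + \sum_m cov (s := UpX :: low A) (Ix m) (@upTx A) (m, I) u
    + \sum_m \sum_mu
        cov (s := UpX :: LoT :: low A) (Iv m mu) (@upTv A) (m, (mu, I)) u
    = 0.

End LocalGeometry.

(** * Generalized metrical multi-time Lagrange spaces *)

(* The metric G^{(a)(b)}_{(i)(j)} = h^{ab} g_{ij} is [vmetric]. *)
Record gml_space (R : realType) (p n : nat) (T : manifold R p)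
    (M : manifold R n) := GMLSpace {
  hmet : chart T -> 'rV[R]_p -> 'M[R]_p;
  gmet : chart T -> chart M -> jco R p n -> 'M[R]_n;
  hmet_semi_riemannian : semi_riemannian hmet;
  gmet_dtensor : dtensor [:: LoX; LoX]
    (fun c d => tens [:: LoX; LoX] (fun i j u => gmet c d u i j));
  gmet_sym : forall c d u, jdom c d u -> (gmet c d u)^T = gmet c d u;
  gmet_rank : forall c d u, jdom c d u -> \rank (gmet c d u) = n;
  gmet_signature : exists r, forall c d u,
    jdom c d u -> has_signature r (gmet c d u)
}.

Section NonlinearConnection.
Variables (R : realType) (p n : nat) (T : manifold R p) (M : manifold R n).
Variable E : gml_space T M.
Local Notation J := (jco R p n).

Definition local_at
    (Mt : chart T -> chart M -> 'I_n -> 'I_p -> 'I_p -> J -> R)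
    (N : chart T -> chart M -> 'I_n -> 'I_p -> 'I_n -> J -> R)
    (c : chart T) (d : chart M) : local_space R p n :=
  LocalSpace (hmet E c) (gmet E c d) (Mt c d) (N c d).

Definition canonical_temporal (c : chart T) (d : chart M) :
    'I_n -> 'I_p -> 'I_p -> J -> R :=
  @canonical_M R p n (hmet E c).

(* The vector fields delta/delta t^a, delta/delta x^i transform tensorially
   ('D_v of the change of coordinates is the image of the vector v). *)
Definition nonlinear_connection
    (Mt : chart T -> chart M -> 'I_n -> 'I_p -> 'I_p -> J -> R)
    (N : chart T -> chart M -> 'I_n -> 'I_p -> 'I_n -> J -> R) : Prop :=
  [/\ forall c d i a b, smooth_on (jdom c d) (Mt c d i a b),
      forall c d i a j, smooth_on (jdom c d) (N c d i a j) &
      forall c c' d d' u, joverlap c c' d d' u ->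
        let phi := jtrans c c' d d' in
        let X := frame (local_at Mt N c d) in
        let X' := frame (local_at Mt N c' d') in
        (forall a, 'D_(X (It a) u) phi u
           = \sum_b jac c c' u.1.1 b a *: X' (It b) (phi u)) /\
        (forall i, 'D_(X (Ix i) u) phi u
           = \sum_j jac d d' u.1.2 j i *: X' (Ix j) (phi u))].

(* [E] with the canonical temporal and the spatial nonlinear connection [N],
   in one chart *)
Definition local_gml
    (N : chart T -> chart M -> 'I_n -> 'I_p -> 'I_n -> J -> R) :=
  local_at canonical_temporal N.

End NonlinearConnection.

(* Main.v *)
(* On the whole open domain of a chart, the Einstein equations say that kappa
   times the stress-energy tensor with its first index raised is the Einstein
   tensor with its first index raised.  Covariant derivatives are local and
   commute with the factor kappa, so the laws are kappa times the conservation
   laws of the stress-energy tensor. *)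

Require Import Defs.
From HB Require Import structures.
From mathcomp Require Import all_boot all_order all_algebra.
From mathcomp Require Import all_classical all_reals all_analysis.
From mathcomp Require Import ring.

Set Implicit Arguments.
Unset Strict Implicit.
Unset Printing Implicit Defensive.

Import Order.TTheory GRing.Theory Num.Theory.
Import numFieldNormedType.Exports.

Local Open Scope classical_set_scope.
Local Open Scope ring_scope.

(* When [f] is not derivable, both sides are the default value 0 of [lim]. *)
Lemma deriveZ_total (R : realType) (V : normedModType R) (k : R)
    (f : V -> R) (x v : V) : 'D_v (k \*: f) x = k *: 'D_v f x.
Proof.
have [df|ndf] := pselect (derivable f x v); first exact: deriveZ.
(* For [k = 0] the product is constant, so it has derivative 0 even where [f] is not derivable. For
   [k != 0], scaling by [k^-1] would carry derivability of [k \*: f] back to [f]. *)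
have [->|k0] := eqVneq k 0.
  rewrite scale0r (_ : 0 \*: f = cst 0) ?derive_cst//.
  by apply/funext => y /=; rewrite scale0r.
have kfK : k^-1 \*: (k \*: f) = f by apply/funext => y /=; rewrite scalerK.
have ndkf : ~ derivable (k \*: f) x v.
  by move=> /(derivableZ (k := k^-1)); rewrite kfK.
by rewrite /derive (dvgP ndf) (dvgP ndkf) [RHS]scaler0.
Qed.

(** A directional derivative depends only on the germ of the function at [x]. No regularity of [f]
    is assumed, so this applies directly to curvature components. *)
Lemma derive_near_scale (R : realType) (V : normedModType R) (k : R)
    (f g : V -> R) (x v : V) :
  (\forall y \near x, g y = k * f y) -> 'D_v g x = k * 'D_v f x.
Proof.
move=> fg; have [->|v0] := eqVneq v 0; first by rewrite !derive0 mulr0.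
rewrite (@near_eq_derive _ _ _ _ (k \*: f))//; exact: deriveZ_total.
Qed.

(** * Locality and homogeneity of covariant derivatives *)

Section LocalConservation.
Variables (R : realType) (p n : nat) (Q : local_space R p n).
Local Notation J := (jco R p n).
Local Notation h := (lh Q).
Local Notation g := (lg Q).

(** Induction on the slots: the base case is a derivative, determined by the germ at [u], and each
    slot adds connection terms linear in the values at [u]. *)
Lemma cov_near_scale (k : R) (A : aidx p n) (s : seq slot)
    (D D' : mix p n s -> J -> R) (u : J) :
  (forall I, \forall v \near u, D' I v = k * D I v) ->
  forall I, cov Q A D' I u = k * cov Q A D I u.
Proof.
elim: s D D' => [|sl s IHs] D D' DD' I /=; first exact: derive_near_scale.
rewrite mulrDr (IHs (fun K => D (I.1, K))); last by move=> K; exact: DD'.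
congr (_ + _); rewrite mulr_sumr; apply: eq_bigr => m _.
by rewrite (nbhs_singleton (DD' (m, I.2))) mulrCA.
Qed.

Lemma cov_near0 (A : aidx p n) (s : seq slot) (D : mix p n s -> J -> R)
    (u : J) :
  (forall I, \forall v \near u, D I v = 0) -> forall I, cov Q A D I u = 0.
Proof.
(* A tensor vanishing near [u] equals 0 times itself there. *)
move=> D0 I; rewrite (@cov_near_scale 0 A s D D) ?mul0r// => K.
by apply: filterS (D0 K) => v ->; rewrite mul0r.
Qed.

Lemma hi_contract (v : J) (a b : 'I_p) : h v.1.1 \in unitmx ->
  \sum_e hi Q v a e * h v.1.1 e b = (a == b)%:R.
Proof. by move=> hU; move/matrixP: (mulVmx hU) => /(_ a b); rewrite !mxE. Qed.

Lemma h_contract (v : J) (a b : 'I_p) : h v.1.1 \in unitmx ->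
  \sum_e h v.1.1 a e * hi Q v e b = (a == b)%:R.
Proof. by move=> hU; move/matrixP: (mulmxV hU) => /(_ a b); rewrite !mxE. Qed.

Lemma gi_contract (v : J) (i j : 'I_n) : g v \in unitmx ->
  \sum_k gi Q v i k * g v k j = (i == j)%:R.
Proof. by move=> gU; move/matrixP: (mulVmx gU) => /(_ i j); rewrite !mxE. Qed.

Variables (kappa : R) (T : blocks R p n).

(** * Einstein equations with the first index raised, block by block *)

Section Pointwise.
Variable v : J.
Hypotheses (hU : h v.1.1 \in unitmx) (gU : g v \in unitmx).
Hypothesis einstein : einstein_equations Q kappa T v.

Lemma upTt_t (m b : 'I_p) :
  upH Q m b v - half_scal Q v * (m == b)%:R
  = kappa * upTt Q T (A := Kt) (m, (b, tt)) v.
Proof.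
case: einstein => eqn _.
(* The Kronecker delta is expanded as [hi] contracted with [h], so that both sides become sums over
   the raised index and agree summand by summand. *)
rewrite -(hi_contract _ _ hU) mulr_sumr -sumrB mulr_sumr.
apply: eq_bigr => e _ /=.
by rewrite [RHS]mulrCA -eqn mulrBr (mulrCA (half_scal _ _)).
Qed.

Lemma upTx_t (m : 'I_n) (b : 'I_p) :
  upRt Q m b v = kappa * upTx Q T (A := Kt) (m, (b, tt)) v.
Proof.
case: einstein => _ [_ [_ [_ [_ [eqn _]]]]].
by rewrite mulr_sumr; apply: eq_bigr => e _ /=; rewrite mulrCA -eqn.
Qed.

Lemma upTv_t (m : 'I_n) (a b : 'I_p) :
  upPvt Q m a b v = kappa * upTv Q T (A := Kt) (m, (a, (b, tt))) v.
Proof.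
case: einstein => _ [_ [_ [_ [_ [_ [eqn _]]]]]].
rewrite mulr_sumr; apply: eq_bigr => k _; rewrite mulr_sumr.
by apply: eq_bigr => e _ /=; rewrite mulrCA -eqn.
Qed.

(** The mixed block vanishes by the Einstein equations; this is why the spatial law has no temporal
    divergence. *)
Lemma upTt_x (m : 'I_p) (j : 'I_n) : upTt Q T (A := Kx) (m, (j, tt)) v = 0.
Proof.
case: einstein => _ [_ [_ [eqn _]]].
by apply: big1 => e _ /=; rewrite eqn mulr0.
Qed.

Lemma upTx_x (m j : 'I_n) :
  upR Q m j v - half_scal Q v * (m == j)%:R
  = kappa * upTx Q T (A := Kx) (m, (j, tt)) v.
Proof.
case: einstein => _ [eqn _].
rewrite -(gi_contract _ _ gU) mulr_sumr -sumrB mulr_sumr.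
apply: eq_bigr => e _ /=.
by rewrite [RHS]mulrCA -eqn mulrBr (mulrCA (half_scal _ _)).
Qed.

Lemma upTv_x (m : 'I_n) (a : 'I_p) (j : 'I_n) :
  upPvx Q m a j v = kappa * upTv Q T (A := Kx) (m, (a, (j, tt))) v.
Proof.
case: einstein => _ [_ [_ [_ [_ [_ [_ [_ eqn]]]]]]].
rewrite mulr_sumr; apply: eq_bigr => k _; rewrite mulr_sumr.
by apply: eq_bigr => e _ /=; rewrite mulrCA -eqn.
Qed.

Lemma upTt_v (m : 'I_p) (j : 'I_n) (b : 'I_p) :
  upTt Q T (A := Kv) (m, (j, (b, tt))) v = 0.
Proof.
case: einstein => _ [_ [_ [_ [eqn _]]]].
by apply: big1 => e _ /=; rewrite eqn mulr0.
Qed.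

Lemma upTx_v (m j : 'I_n) (b : 'I_p) :
  upPxv Q m j b v = kappa * upTx Q T (A := Kv) (m, (j, (b, tt))) v.
Proof.
case: einstein => _ [_ [_ [_ [_ [_ [_ [eqn _]]]]]]].
by rewrite mulr_sumr; apply: eq_bigr => e _ /=; rewrite mulrCA -eqn.
Qed.

Lemma upTv_v (m : 'I_n) (a : 'I_p) (j : 'I_n) (b : 'I_p) :
  upS Q m a j b v - half_scal Q v * (m == j)%:R * (b == a)%:R
  = kappa * upTv Q T (A := Kv) (m, (a, (j, (b, tt)))) v.
Proof.
case: einstein => _ [_ [eqn _]].
(* The two deltas become the contractions of [gi] with [g] and of [h] with [hi]; their product is
   [vmetric] with its first vertical index moved by the metric. The Greek part of that index is
   lowered, hence the order [h], [hi]. *)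
rewrite -(gi_contract _ _ gU) eq_sym -(h_contract _ _ hU) -mulrA.
rewrite big_distrlr/= mulr_sumr -sumrB mulr_sumr; apply: eq_bigr => k _ /=.
rewrite mulr_sumr -sumrB mulr_sumr.
apply: eq_bigr => e _ /=.
rewrite [RHS]mulrCA -eqn mulrBr /vmetric; ring.
Qed.

End Pointwise.

(** * The three laws at a point of a chart *)

Variable u : J.
Hypothesis hU : \forall v \near u, h v.1.1 \in unitmx.
Hypothesis gU : \forall v \near u, g v \in unitmx.
Hypothesis einstein : \forall v \near u, einstein_equations Q kappa T v.
Hypothesis conservation : conservation_laws Q T u.

Lemma conservation_t (b : 'I_p) :
  \sum_mu cov Q (It mu)
    (tens [:: UpT; LoT] (fun (m b : 'I_p) (v : J) =>
       upH Q m b v - half_scal Q v * (m == b)%:R)) (mu, (b, tt)) u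
  = - (\sum_m cov Q (Ix m) (tens [:: UpX; LoT] (upRt Q)) (m, (b, tt)) u)
    - \sum_m \sum_mu cov Q (Iv m mu)
        (tens [:: UpX; LoT; LoT] (upPvt Q)) (m, (mu, (b, tt))) u.
Proof.
rewrite -opprD; apply/eqP; rewrite -addr_eq0 addrA; apply/eqP.
(* Zero is written as [kappa] times the stress-energy divergence, and the three divergences are
   compared term by term. Nothing is divided by [kappa]. *)
rewrite -[RHS](mulr0 kappa).
rewrite -[X in _ = _ * X](conservation (A := Kt) (b, tt)) !mulrDr !mulr_sumr.
congr (_ + _ + _); apply: eq_bigr => m _.
- apply: cov_near_scale => -[a [c []]]; near=> v.
  by apply: upTt_t; near: v.
- apply: cov_near_scale => -[a [c []]]; near=> v.
  by apply: upTx_t; near: v.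
- rewrite mulr_sumr; apply: eq_bigr => mu _.
  apply: cov_near_scale => -[i [a [c []]]]; near=> v.
  by apply: upTv_t; near: v.
Unshelve. all: by end_near. Qed.

Lemma conservation_x (j : 'I_n) :
  \sum_m cov Q (Ix m)
    (tens [:: UpX; LoX] (fun (m j : 'I_n) (v : J) =>
       upR Q m j v - half_scal Q v * (m == j)%:R)) (m, (j, tt)) u
  = - (\sum_m \sum_mu cov Q (Iv m mu)
        (tens [:: UpX; LoT; LoX] (upPvx Q)) (m, (mu, (j, tt))) u).
Proof.
apply/eqP; rewrite -addr_eq0; apply/eqP.
rewrite -[RHS](mulr0 kappa).
rewrite -[X in _ = _ * X](conservation (A := Kx) (j, tt)).
(* The temporal divergence drops out: its tensor vanishes on a neighbourhood of [u], hence so does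
   its covariant derivative at [u]. *)
rewrite (big1 _ _ (fun m => cov Q (It m) _ _ u)) => [|m _]; last first.
  apply: cov_near0 => -[a [i []]]; near=> v.
  by apply: upTt_x; near: v.
rewrite add0r mulrDr !mulr_sumr; congr (_ + _); apply: eq_bigr => m _.
- apply: cov_near_scale => -[i [k []]]; near=> v.
  by apply: upTx_x; near: v.
- rewrite mulr_sumr; apply: eq_bigr => mu _.
  apply: cov_near_scale => -[i [a [k []]]]; near=> v.
  by apply: upTv_x; near: v.
Unshelve. all: by end_near. Qed.

Lemma conservation_v (j : 'I_n) (b : 'I_p) :
  \sum_m \sum_mu cov Q (Iv m mu)
    (tens [:: UpX; LoT; LoX; UpT]
      (fun (m : 'I_n) (mu : 'I_p) (j : 'I_n) (b : 'I_p) (v : J) =>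
       upS Q m mu j b v - half_scal Q v * (m == j)%:R * (b == mu)%:R))
    (m, (mu, (j, (b, tt)))) u
  = - (\sum_m cov Q (Ix m)
        (tens [:: UpX; LoX; UpT] (upPxv Q)) (m, (j, (b, tt))) u).
Proof.
(* [addrC] puts the horizontal divergence before the vertical one, as in [conservation_laws]. *)
apply/eqP; rewrite -addr_eq0 addrC; apply/eqP.
rewrite -[RHS](mulr0 kappa).
rewrite -[X in _ = _ * X](conservation (A := Kv) (j, (b, tt))).
rewrite (big1 _ _ (fun m => cov Q (It m) _ _ u)) => [|m _]; last first.
  apply: cov_near0 => -[a [i [c []]]]; near=> v.
  by apply: upTt_v; near: v.
rewrite add0r mulrDr !mulr_sumr; congr (_ + _); apply: eq_bigr => m _.
- apply: cov_near_scale => -[i [k [c []]]]; near=> v.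
  by apply: upTx_v; near: v.
- rewrite mulr_sumr; apply: eq_bigr => mu _.
  apply: cov_near_scale => -[i [a [k [c []]]]]; near=> v.
  by apply: upTv_v; near: v.
Unshelve. all: by end_near. Qed.

End LocalConservation.

(** * From chart domains to neighbourhoods *)

(** Chart images are open and the fibre coordinates are unrestricted. Hypotheses on a whole chart
    domain thus hold near each of its points, as differentiating them requires. *)
Lemma jdom_nbhs (R : realType) (p n : nat) (T : manifold R p)
    (M : manifold R n) (c : chart T) (d : chart M) (u : jco R p n) :
  jdom c d u -> nbhs u (jdom c d).
Proof.
move=> [uc ud].
have nc : nbhs u.1.1 (img c).
  by apply: open_nbhs_nbhs; split=> //; exact: img_open.
have nd : nbhs u.1.2 (img d).
  by apply: open_nbhs_nbhs; split=> //; exact: img_open.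
case: u {uc ud} nc nd => -[t x] y /= nc nd.
exists (img c `*` img d, setT) => /=.
  by split; [exists (img c, img d)|exact: filterT].
by move=> -[[t' x'] y'] /= [].
Qed.

Theorem theorem4p4 (R : realType) (p n : nat)
    (T : manifold R p) (M : manifold R n) (E : gml_space T M)
    (N : chart T -> chart M -> 'I_n -> 'I_p -> 'I_n -> jco R p n -> R)
    (kappa : R) (SE : chart T -> chart M -> blocks R p n) :
  nonlinear_connection E (canonical_temporal E) N ->
  (forall A B : kind, dtensor (low A ++ low B) (fun c d => SE c d A B)) ->
  (forall c d u, jdom c d u ->
     einstein_equations (local_gml E N c d) kappa (SE c d) u) ->
  (forall c d u, jdom c d u ->
     conservation_laws (local_gml E N c d) (SE c d) u) ->
  forall (c : chart T) (d : chart M) (u : jco R p n), jdom c d u ->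
  let Q := local_gml E N c d in
  (forall b : 'I_p,
     \sum_mu cov Q (It mu)
       (tens [:: UpT; LoT] (fun (m b : 'I_p) (v : jco R p n) =>
          upH Q m b v - half_scal Q v * (m == b)%:R)) (mu, (b, tt)) u
     = - (\sum_m cov Q (Ix m) (tens [:: UpX; LoT] (upRt Q)) (m, (b, tt)) u)
       - \sum_m \sum_mu cov Q (Iv m mu)
           (tens [:: UpX; LoT; LoT] (upPvt Q)) (m, (mu, (b, tt))) u) /\
  (forall j : 'I_n,
     \sum_m cov Q (Ix m)
       (tens [:: UpX; LoX] (fun (m j : 'I_n) (v : jco R p n) =>
          upR Q m j v - half_scal Q v * (m == j)%:R)) (m, (j, tt)) u
     = - (\sum_m \sum_mu cov Q (Iv m mu)
           (tens [:: UpX; LoT; LoX] (upPvx Q)) (m, (mu, (j, tt))) u)) /\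
  (forall (j : 'I_n) (b : 'I_p),
     \sum_m \sum_mu cov Q (Iv m mu)
       (tens [:: UpX; LoT; LoX; UpT]
         (fun (m : 'I_n) (mu : 'I_p) (j : 'I_n) (b : 'I_p) (v : jco R p n) =>
          upS Q m mu j b v - half_scal Q v * (m == j)%:R * (b == mu)%:R))
       (m, (mu, (j, (b, tt)))) u
     = - (\sum_m cov Q (Ix m)
           (tens [:: UpX; LoX; UpT] (upPxv Q)) (m, (j, (b, tt))) u)).
Proof.
move=> _ _ einstein conservation c d u ucd Q.
have hU : \forall v \near u, lh Q v.1.1 \in unitmx.
  apply: filterS (jdom_nbhs ucd) => v [vc _].
  by have [_ _ _ + _] := hmet_semi_riemannian E; apply.
have gU : \forall v \near u, lg Q v \in unitmx.
  apply: filterS (jdom_nbhs ucd) => v vcd.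
  (* Full rank [n] of the square matrix [g] gives its invertibility. *)
  by rewrite -row_free_unit /row_free; apply/eqP; exact: gmet_rank.
have ein : \forall v \near u, einstein_equations Q kappa (SE c d) v.
  by apply: filterS (jdom_nbhs ucd) => v; exact: einstein.
have con : conservation_laws Q (SE c d) u by exact: conservation.
split; [|split].
- by move=> b; exact: conservation_t hU ein con b.
- by move=> j; exact: conservation_x gU ein con j.
- by move=> j b; exact: conservation_v hU gU ein con j b.
Qed.
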